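(* Let $n\geq2$, let $f:\mathbb{C}^n\longrightarrow\mathbb{C}$ be a polynomial whose affine critical points are isolated, and let $c\in\mathbb{C}$. Let $h_c$ be the monodromy induced on $H_q(F_{\mathit{gen}})$ by a small circle around $c$, and for $\lambda\in\mathbb{C}$ let $E_\lambda=\operatorname{Ker}(h_c-\lambda\,\mathrm{id})^p\subset H_q(F_{\mathit{gen}})$ for a large integer $p$. If $\lambda\neq1$ then $E_\lambda\subset V_q(c)$.
   Context: Homology is with complex coefficients. The affine critical points are the points of $\mathbb{C}^n$ where the gradient of $f$ vanishes. The bifurcation set $\mathcal{B}$ is the minimal (finite) set of points of $\mathbb{C}$ such that $f:\mathbb{C}^n\setminus f^{-1}(\mathcal{B})\to\mathbb{C}\setminus\mathcal{B}$ is a locally trivial fibration. Let $D^2_\varepsilon(c)$ be the disk centered at $c$ of small radius $\varepsilon$, with $D^2_\varepsilon(c)\cap\mathcal{B}\subset\{c\}$, and $T_c=f^{-1}(D^2_\varepsilon(c))$. The generic fiber is $F_{\mathit{gen}}=f^{-1}(s)$ for a fixed $s\in D^2_\varepsilon(c)$, $s\neq c$, and $h_c$ is the monodromy of $f$ over a circle around $c$ in $D^2_\varepsilon(c)\setminus\{c\}$ through $s$. Let $k_c:H_q(F_{\mathit{gen}})\to H_q(T_c)$ be induced by inclusion; $V_q(c)=\operatorname{Ker}k_c$ is the space of vanishing cycles for the value $c$. *)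

(* Defs.v *)
From HB Require Import structures.
From mathcomp Require Import all_boot all_order all_algebra.
From mathcomp Require Import all_classical all_reals all_analysis.
From mathcomp Require Import complex.
From mathcomp Require mpoly.
From mathcomp Require Import freeg.
Set Implicit Arguments.
Unset Strict Implicit.
Unset Printing Implicit Defensive.
Import Order.TTheory GRing.Theory Num.Theory.
Import numFieldNormedType.Exports.
Local Open Scope classical_set_scope.
Local Open Scope ring_scope.
Local Open Scope quotient_scope.
Local Open Scope complex_scope.

(* Homology ker d0 / im d1 of  U --d1--> V --d0--> W, as a module.
   d0 \o d1 = 0 is not needed to form it: the submodule divided out is
   im d1 intersected with ker d0. *)
Section Homology.
Context {K : nzRingType} {U V W : lmodType K}.
Variables (d1 : {linear U -> V}) (d0 : {linear V -> W}).

Definition cycle_pred : {pred V} := [pred v | d0 v == 0].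

Fact cycle_closed : submod_closed cycle_pred.
Proof.
split=> [|a v w]; rewrite !inE ?linear0// => /eqP dv /eqP dw.
by rewrite linearP dv dw scaler0 addr0.
Qed.
HB.instance Definition _ :=
  GRing.isSubmodClosed.Build K V cycle_pred cycle_closed.

Definition cycles := {v : V | v \in cycle_pred}.
HB.instance Definition _ := SubType.on cycles.
HB.instance Definition _ := Choice.on cycles.
HB.instance Definition _ := [SubChoice_isSubLmodule of cycles by <:].

Definition boundary_pred : {pred cycles} :=
  fun z => `[< exists u, \val z = d1 u >].

Fact boundary_closed : zmod_closed boundary_pred.
Proof.
split=> [|z w]; first by apply/asboolP; exists 0; rewrite linear0 raddf0.
move=> /asboolP[u zu] /asboolP[v wv]; apply/asboolP.
by exists (u - v); rewrite !raddfB /= zu wv.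
Qed.
HB.instance Definition _ :=
  GRing.isZmodClosed.Build cycles boundary_pred boundary_closed.

Definition homology := Quotient.quot boundary_pred.
HB.instance Definition _ := GRing.Zmodule.on homology.

Definition hclass (z : cycles) : homology :=
  \pi_(Quotient.quot boundary_pred) z.

Lemma hclass_eq (z w : cycles) :
  hclass z = hclass w <-> exists u, \val z - \val w = d1 u.
Proof.
have <- : \val (z - w) = \val z - \val w by rewrite raddfB.
split=> [/eqP|h].
  by rewrite -[_ == _]Quotient.idealrBE => /asboolP.
by apply/eqP; rewrite -[_ == _]Quotient.idealrBE; apply/asboolP.
Qed.

Lemma hclassD : {morph hclass : z w / z + w}.
Proof. by move=> z w; rewrite /hclass piE. Qed.

Lemma hclass_reprK (x : homology) : hclass (repr x) = x.
Proof. exact: (@reprK _ (Quotient.quot boundary_pred)). Qed.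

Definition hscale (a : K) (x : homology) : homology := hclass (a *: repr x).

Lemma hscaleE a z : hscale a (hclass z) = hclass (a *: z).
Proof.
apply/hclass_eq; have /hclass_eq[u hu] := hclass_reprK (hclass z).
by exists (a *: u); rewrite [RHS]linearZ -hu /= scalerBr.
Qed.

Fact hscaleA a b x : hscale a (hscale b x) = hscale (a * b) x.
Proof. by rewrite -[x]hclass_reprK !hscaleE scalerA. Qed.

Fact hscale1 : left_id 1 hscale.
Proof. by move=> x; rewrite -[x]hclass_reprK !hscaleE scale1r. Qed.

Fact hscaleDr : right_distributive hscale +%R.
Proof.
move=> a x y; rewrite -[x]hclass_reprK -[y]hclass_reprK -hclassD.
by rewrite !hscaleE scalerDr hclassD.
Qed.

Fact hscaleDl x : {morph hscale^~ x : a b / a + b}.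
Proof.
by move=> a b; rewrite -[x]hclass_reprK !hscaleE scalerDl hclassD.
Qed.

HB.instance Definition _ := GRing.Zmodule_isLmodule.Build K homology
  hscaleA hscale1 hscaleDr hscaleDl.

Fact hclass_is_linear : linear hclass.
Proof. by move=> a z w; rewrite hclassD -hscaleE. Qed.
HB.instance Definition _ := GRing.isLinear.Build K cycles homology _ hclass
  hclass_is_linear.

End Homology.

Section HomologyMap.
Context {K : nzRingType} {U V W U' V' W' : lmodType K}.
Variables (d1 : {linear U -> V}) (d0 : {linear V -> W}).
Variables (d1' : {linear U' -> V'}) (d0' : {linear V' -> W'}).
Variables (f1 : {linear U -> U'}) (f : {linear V -> V'}).
Variable (f0 : {linear W -> W'}).
Hypothesis fd1 : forall u, f (d1 u) = d1' (f1 u).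
Hypothesis fd0 : forall v, f0 (d0 v) = d0' (f v).

Fact cycles_map_subproof (z : cycles d0) : f (\val z) \in cycle_pred d0'.
Proof. by case: z => z /= /eqP dz; rewrite inE -fd0 dz linear0. Qed.

Definition cycles_map (z : cycles d0) : cycles d0' :=
  Sub (f (\val z)) (cycles_map_subproof z).

Definition homology_map (x : homology d1 d0) : homology d1' d0' :=
  hclass d1' (cycles_map (repr x)).

Lemma homology_mapE z : homology_map (hclass d1 z) = hclass d1' (cycles_map z).
Proof.
apply/hclass_eq; have /hclass_eq[u hu] := hclass_reprK (hclass d1 z).
by exists (f1 u); rewrite -fd1 -hu [RHS]raddfB.
Qed.

Fact homology_map_is_linear : linear homology_map.
Proof.
move=> a x y; rewrite -[x]hclass_reprK -[y]hclass_reprK.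
rewrite -linearP !homology_mapE -linearP.
by congr (hclass _ _); apply: val_inj; rewrite /= !linearP.
Qed.
End HomologyMap.

(* The field of complex numbers, bundled as a numClosedFieldType so that it
   carries the topology of its norm; R[i] itself has no topology attached. *)
Definition Cplx (R : realType) : numClosedFieldType := R[i].

Section SingularHomology.
Variable R : realType.
Implicit Types X Y : topologicalType.

Definition simplex_set q : set 'rV[R]_q.+1 :=
  [set x | (forall i, 0 <= x ord0 i) /\ \sum_i x ord0 i = 1].
Arguments simplex_set : clear implicits.

Definition simplex q : topologicalType := set_type (simplex_set q).

(* The i-th face map of standard simplices inserts a zero coordinate at i. *)
Definition face_row q (i : 'I_q.+2) (x : 'rV[R]_q.+1) : 'rV[R]_q.+2 :=
  \row_j (if unlift i j is Some k then x ord0 k else 0).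

Fact face_subproof q i (x : simplex q) :
  face_row i (set_val x) \in simplex_set q.+1.
Proof.
have [x0 x1] : simplex_set q (set_val x) by exact: set_valP.
apply/mem_set; split=> [j|]; first by rewrite mxE; case: unlift.
rewrite (bigD1_ord i) //= mxE unlift_none add0r -[RHS]x1.
by apply: eq_bigr => k _; rewrite mxE liftK.
Qed.

Definition face_fun q i (x : simplex q) : simplex q.+1 :=
  exist _ (face_row i (set_val x)) (face_subproof i x).

Fact face_row_continuous q (i : 'I_q.+2) : continuous (face_row i).
Proof.
move=> x A [P Px PA]; exists (fun _ k => P ord0 (fintype.lift i k)).
  by move=> a k; have := Px ord0 (fintype.lift i k); rewrite mxE liftK (ord1 a).
move=> y Py; apply: PA => a j; rewrite (ord1 a) mxE.
case: unliftP => [k ->|jE].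
  exact: Py.
by have := Px ord0 j; rewrite mxE jE unlift_none; exact: nbhs_singleton.
Qed.

Fact face_continuous q (i : 'I_q.+2) : continuous (@face_fun q i).
Proof.
apply: continuous_comp_initial => x.
apply: (@continuous_comp _ _ _ (set_val : simplex q -> _) (face_row i)).
  exact: initial_continuous.
exact: face_row_continuous.
Qed.

Definition face q (i : 'I_q.+2) : continuousType (simplex q) (simplex q.+1) :=
  mkcts (@face_continuous q i).

Definition chain X q := {freeg (continuousType (simplex q) X) / Cplx R}.
HB.instance Definition _ X q := GRing.Lmodule.on (chain X q).

Fact fglift_is_linear (S : choiceType) (M : lmodType (Cplx R)) (F : S -> M) :
  linear (fglift F : {freeg S / Cplx R} -> M).
Proof.
have F0 : fglift F 0 = 0 by have := lift_is_additive F 0 0; rewrite !subrr.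
have FN D : fglift F (- D) = - fglift F D.
  by have := lift_is_additive F 0 D; rewrite F0 !sub0r.
have FD D E : fglift F (D + E) = fglift F D + fglift F E.
  by have := lift_is_additive F D (- E); rewrite opprK FN opprK.
move=> a D E; rewrite FD; congr (_ + _).
have Fsum (I : Type) (r : seq I) (G : I -> {freeg S / Cplx R}) :
    fglift F (\sum_(j <- r) G j) = \sum_(j <- r) fglift F (G j).
  by apply: (big_morph _ FD F0).
rewrite -[D in RHS]freeg_sumE [a *: D]/(fgscale a D) /fgscale !Fsum scaler_sumr.
by apply: eq_bigr => s _; rewrite !liftU scalerA.
Qed.

Definition chain_of X q (s : continuousType (simplex q) X) : chain X q :=
  << s >>.

(* Degree 0 uses 0.-1 = 0: the boundary of a 0-chain is 0, so that every
   0-chain is a cycle (unreduced homology). *)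
Definition boundary X q : chain X q -> chain X q.-1 :=
  match q with
  | 0 => fun=> 0
  | q'.+1 => fglift (fun s : continuousType (simplex q'.+1) X =>
      \sum_(i < q'.+2)
        (-1) ^+ i *: chain_of (s \o face i))
  end.

Arguments boundary : simpl never.

Fact boundary_is_linear X q : linear (@boundary X q).
Proof.
case: q => [|q] a D E; rewrite /boundary; last exact: fglift_is_linear.
by rewrite scaler0 addr0.
Qed.
HB.instance Definition _ X q := GRing.isLinear.Build (Cplx R) (chain X q)
  (chain X q.-1) _ (@boundary X q) (@boundary_is_linear X q).

Definition chain_map X Y (g : continuousType X Y) q : chain X q -> chain Y q :=
  fglift (fun s : continuousType (simplex q) X =>
    chain_of (g \o s)).

Fact chain_map_is_linear X Y g q : linear (@chain_map X Y g q).
Proof. exact: fglift_is_linear. Qed.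
HB.instance Definition _ X Y g q := GRing.isLinear.Build (Cplx R) (chain X q)
  (chain Y q) _ (@chain_map X Y g q) (@chain_map_is_linear X Y g q).

Lemma chain_ext X q (M : lmodType (Cplx R)) (F G : {linear chain X q -> M}) :
  (forall s, F (chain_of s) = G (chain_of s)) -> F =1 G.
Proof.
move=> FG D.
have -> : D = \sum_(s <- dom D) (coeff s D) *: chain_of s :> chain X q.
  apply/eqP/freeg_eqP => s; rewrite -{1}[D]freeg_sumE; congr (coeff _ _).
  apply: eq_bigr => t _; apply/eqP/freeg_eqP => u.
  by rewrite coeffZ !coeffU mul1r.
by rewrite !linear_sum; apply: eq_bigr => s _; rewrite !linearZ FG.
Qed.

Lemma boundary_chain_of X q (s : continuousType (simplex q.+1) X) :
  boundary (chain_of s) = \sum_(i < q.+2) (-1) ^+ i *: chain_of (s \o face i).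
Proof. by rewrite /boundary liftU scale1r. Qed.

Lemma chain_map_of X Y (g : continuousType X Y) q
    (s : continuousType (simplex q) X) :
  chain_map g (chain_of s) = chain_of (g \o s).
Proof. by rewrite /chain_map liftU scale1r. Qed.

Lemma boundary_chain_map X Y (g : continuousType X Y) q (D : chain X q) :
  chain_map g (boundary D) = boundary (chain_map g D).
Proof.
case: q D => [|q] D; first by rewrite linear0.
pose F : {linear chain X q.+1 -> chain Y q} :=
  @chain_map _ _ g q \o @boundary X q.+1.
pose G : {linear chain X q.+1 -> chain Y q} :=
  @boundary Y q.+1 \o @chain_map _ _ g q.+1.
suff /(_ D) : F =1 G by [].
apply: chain_ext => s; rewrite {}/F {}/G /=.
rewrite boundary_chain_of chain_map_of boundary_chain_of linear_sum.
apply: eq_bigr => i _; rewrite linearZ; congr (_ *: _).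
rewrite [LHS]chain_map_of; congr chain_of; exact/continuousEP.
Qed.

End SingularHomology.
Section SingularHomologyModule.
Variable R : realType.

Definition sing_homology (X : topologicalType) (q : nat) :=
  homology (@boundary R X q.+1 : {linear chain R X q.+1 -> chain R X q})
           (@boundary R X q).
HB.instance Definition _ X q := GRing.Lmodule.on (sing_homology X q).

Definition sing_homology_map (X Y : topologicalType) (g : continuousType X Y)
    (q : nat) : sing_homology X q -> sing_homology Y q :=
  homology_map (@boundary R Y q.+1) (@boundary_chain_map R X Y g q).

Fact sing_homology_map_is_linear X Y g q : linear (@sing_homology_map X Y g q).
Proof.
exact: (homology_map_is_linear (f1 := @chain_map R X Y g q.+1)
  (@boundary_chain_map R X Y g q.+1)).
Qed.
HB.instance Definition _ X Y g q := GRing.isLinear.Build (Cplx R)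
  (sing_homology X q) (sing_homology Y q) _ (@sing_homology_map X Y g q)
  (@sing_homology_map_is_linear X Y g q).

End SingularHomologyModule.

Section Subspaces.
Context {T : topologicalType} (A B : set T).
Hypothesis AB : A `<=` B.

Definition incl_fun (x : set_type A) : set_type B :=
  exist _ (set_val x) (mem_set (AB (set_valP x))).

Fact incl_continuous : continuous incl_fun.
Proof. by apply: continuous_comp_initial; exact: initial_continuous. Qed.

Definition incl : continuousType (set_type A) (set_type B) :=
  mkcts incl_continuous.
End Subspaces.

Definition homeomorphism (X Y : topologicalType) (phi : X -> Y) :=
  continuous phi /\
  exists psi : Y -> X, [/\ continuous psi, cancel phi psi & cancel psi phi].

(* For D open: the restriction f^-1(D) -> D of f is a (topological) locally
   trivial fibration. *)
Definition locally_trivial_over (X Y : topologicalType) (f : X -> Y)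
    (D : set Y) :=
  forall b, D b -> exists U : set Y, [/\ open U, U b, U `<=` D &
    exists (F : topologicalType)
           (phi : set_type (f @^-1` U) -> (set_type U * F)%type),
      homeomorphism phi /\
      forall x, set_val (phi x).1 = f (set_val x)].

Section GenEigenspace.
Context {K : nzRingType} {V : lmodType K}.

(* Ker (h - lambda id)^p *)
Definition gen_eigenspace (h : V -> V) (lambda : K) (p : nat) : set V :=
  [set x | iter p (fun y => h y - lambda *: y) x = 0].
End GenEigenspace.

Definition unit_interval (R : realType) : topologicalType :=
  set_type ([set` `[0%R, 1%R]] : set R).

Section PolynomialMap.
Context {R : realType} {n : nat} (f : mpoly.mpoly n (Cplx R)).
Local Notation Cn := 'rV[Cplx R]_n.

Definition polyfun (x : Cn) : Cplx R := mpoly.meval (fun i => x ord0 i) f.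

Definition critical_points : set Cn :=
  [set x | forall i, mpoly.meval (fun j => x ord0 j) (mpoly.mderiv i f) = 0].

(* B is the least finite set outside of which f is a locally trivial
   fibration. *)
Definition is_bifurcation_set (B : set (Cplx R)) :=
  [/\ finite_set B, locally_trivial_over polyfun (~` B) &
      forall B', finite_set B' -> locally_trivial_over polyfun (~` B') ->
        B `<=` B'].

Definition disk (c : Cplx R) (eps : R) : set (Cplx R) :=
  [set z | `|z - c| <= (eps%:C : Cplx R)].

Definition fiber (s : Cplx R) : set Cn := polyfun @^-1` [set s].

Definition tube (c : Cplx R) (eps : R) : set Cn := polyfun @^-1` disk c eps.

(* The circle centered at c, based at s, run once counterclockwise. *)
Definition circle_loop (c s : Cplx R) (t : R) : Cplx R :=
  c + (s - c) * (cos (2 * pi * t) +i* sin (2 * pi * t) : Cplx R).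

(* Total space over [0, 1] of the pullback of f along gamma. *)
Definition pullback (gamma : R -> Cplx R)
    : set (unit_interval R * Cn)%type :=
  [set tx | polyfun tx.2 = gamma (set_val tx.1)].

(* Phi trivializes the pullback of f along the circle, starting from the
   identity of the fiber over s; g is the return map at time 1. Such a g is
   determined up to isotopy, hence the map it induces on homology is unique. *)
Definition is_geometric_monodromy (c s : Cplx R)
    (g : continuousType (set_type (fiber s)) (set_type (fiber s))) :=
  exists Phi : unit_interval R * set_type (fiber s) ->
               set_type (pullback (circle_loop c s)),
    [/\ homeomorphism Phi,
        forall t x, (set_val (Phi (t, x))).1 = t,
        forall (t : unit_interval R) x, set_val t = 0 ->
          (set_val (Phi (t, x))).2 = set_val x &
        forall (t : unit_interval R) x, set_val t = 1 ->
          (set_val (Phi (t, x))).2 = set_val (g x)].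

Definition is_monodromy (c s : Cplx R) (q : nat)
    (h : sing_homology R (set_type (fiber s)) q ->
         sing_homology R (set_type (fiber s)) q) :=
  exists2 g, is_geometric_monodromy c g & h = @sing_homology_map R _ _ g q.

Lemma fiber_sub_tube (c s : Cplx R) (eps : R) :
  disk c eps s -> fiber s `<=` tube c eps.
Proof. by move=> cs x /= xs; rewrite /tube /= xs. Qed.

Definition vanishing_cycles (c s : Cplx R) (eps : R) (cs : disk c eps s)
    (q : nat) : set (sing_homology R (set_type (fiber s)) q) :=
  [set x | sing_homology_map (incl (fiber_sub_tube cs)) x = 0].

End PolynomialMap.

Arguments is_geometric_monodromy {R n} f c s g.
Arguments is_monodromy {R n} f c s {q} h.
Arguments vanishing_cycles {R n} f {c s eps} cs q.

(* Main.v *)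
From HB Require Import structures.
Require Import Defs.
From mathcomp Require Import all_boot all_order all_algebra.
From mathcomp Require Import all_classical all_reals all_analysis.
From mathcomp Require mpoly.
From mathcomp Require Import complex freeg zify.
Set Implicit Arguments.
Unset Strict Implicit.
Unset Printing Implicit Defensive.
Import Order.TTheory GRing.Theory Num.Theory.
Import numFieldNormedType.Exports.
Local Open Scope classical_set_scope.
Local Open Scope ring_scope.

(** Let k be the map in homology induced by the inclusion of the fiber over s
in the tube. Transporting the fiber along the circle moves each point of it
inside the tube, because the circle through s stays in the disk. Composed with
the projection to the total space, the trivialization of the pullback is
therefore a homotopy, inside the tube, from the inclusion of the fiber to the
inclusion composed with the geometric monodromy. Homotopy invariance of
singular homology (sing_homology_map_homotopy) gives k (h x) = k x.

The rest is linear algebra (gen_eigenspace_sub_ker): k turns h - lambda id into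
multiplication by 1 - lambda, so (h - lambda id)^p x = 0 yields
(1 - lambda)^p k x = 0, and k x = 0 as lambda differs from 1.

Homotopy invariance is proved with the prism operator, which cuts the product
of an interval and a simplex into simplices. All maps from a simplex to that
product which occur are affine and send vertices to vertices; such a map is
given by a map u on vertices and the set P of the vertices sent to the end 1 of
the interval. Composing with a face map of the source or of the target only
changes u and P (prism_simplex_face, prism_simplex_of_face), so the boundary
formula reduces to identities between maps of finite ordinals and to the
cancellation of signed sums (prism_telescope). *)

(** * Generalized eigenvectors and invariant linear maps *)

Lemma gen_eigenspace_sub_ker (K : fieldType) (V W : lmodType K)
    (k : {linear V -> W}) (h : V -> V) (lambda : K) (p : nat) :
  (forall x, k (h x) = k x) -> lambda != 1 ->
  gen_eigenspace h lambda p `<=` [set x | k x = 0].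
Proof.
move=> kh lambda1 x /= hx0.
have : k (iter p (fun y => h y - lambda *: y) x) = (1 - lambda) ^+ p *: k x.
  elim: p {hx0} => [|p IHp] /=; first by rewrite scale1r.
  rewrite linearB linearZ /= kh IHp !scalerA -scalerBl; congr (_ *: _).
  by rewrite exprS mulrBl mul1r.
rewrite hx0 linear0 => /esym/eqP.
by rewrite scaler_eq0 expf_eq0 subr_eq0 eq_sym (negPf lambda1) andbF => /eqP.
Qed.

(** * Cancellation in the boundary of the prism operator *)

(** G i j stands for the j-th face of the i-th simplex of a prism, and L i j for
the i-th simplex of the prism over the j-th face of the base. A face G i j with
j < i or j > i + 1 lies in the side of the prism over a face of the base, and
cancels against L with the opposite sign. The faces D i = G i i and
D (i + 1) = G i (i + 1) are those interior to the prism or in one of its two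
ends: each interior one is shared by two consecutive simplices, and only the
two ends D 0 and D (q + 1) survive. *)
Lemma prism_telescope (K : nzRingType) (M : lmodType K) (q : nat)
    (D : nat -> M) (G L : nat -> nat -> M) :
  (forall i, (i <= q)%N -> G i i = D i) ->
  (forall i, (i <= q)%N -> G i i.+1 = D i.+1) ->
  (forall i j, (j <= i < q)%N -> G i.+1 j = L i j) ->
  (forall i j, (i < j <= q)%N -> G i j.+1 = L i j) ->
  \sum_(i < q.+1) (-1) ^+ i *: (\sum_(j < q.+2) (-1) ^+ j *: G i j) +
  \sum_(j < q.+1) (-1) ^+ j *: (\sum_(i < q) (-1) ^+ i *: L i j) =
  D 0%N - D q.+1.
Proof.
move=> GD GD1 Glow Ghigh.
(* The faces lying over faces of the base, below and above the diagonal. *)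
pose low i := \sum_(0 <= j < i) (-1) ^+ (i + j) *: G i j.
pose high i := \sum_(i.+2 <= j < q.+2) (-1) ^+ (i + j) *: G i j.
have rowG i : (i <= q)%N ->
    (-1) ^+ i *: (\sum_(j < q.+2) (-1) ^+ j *: G i j) =
    low i + high i + (D i - D i.+1).
  move=> iq; rewrite -(big_mkord xpredT (fun j => (-1) ^+ j *: G i j)).
  rewrite scaler_sumr (big_cat_nat (n := i)) /=; [|lia|lia].
  rewrite [X in _ + X]big_ltn; last by lia.
  rewrite [X in _ + (_ + X)]big_ltn; last by lia.
  rewrite !scalerA -!exprD addnn addnS addnn exprS -mul2n exprM sqrrN !expr1n.
  rewrite mulr1 scale1r scaleN1r GD // GD1 // [D i + (_ + _)]addrA.
  rewrite [X in _ = X]addrAC -!addrA; congr (_ + _).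
    by apply: eq_bigr => j _; rewrite scalerA exprD.
  do 2!congr (_ + _).
  by apply: eq_bigr => j _; rewrite scalerA exprD.
have colL : \sum_(j < q.+1) (-1) ^+ j *: (\sum_(i < q) (-1) ^+ i *: L i j) =
    - \sum_(0 <= i < q) (low i.+1 + high i).
  under eq_bigr do rewrite scaler_sumr.
  rewrite exchange_big /= -sumrN -(big_mkord xpredT
    (fun i => \sum_(j < q.+1) (-1) ^+ j *: ((-1) ^+ i *: L i j))).
  rewrite big_nat [RHS]big_nat; apply: eq_bigr => i /= iq.
  rewrite -(big_mkord xpredT (fun j => (-1) ^+ j *: ((-1) ^+ i *: L i j))).
  rewrite (big_cat_nat (n := i.+1)) /=; [|lia|lia].
  rewrite opprD -!sumrN; congr (_ + _).
    rewrite big_nat [RHS]big_nat; apply: eq_bigr => j ij.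
    rewrite Glow; last by lia.
    by rewrite scalerA -exprD addSn exprS mulN1r scaleNr opprK addnC.
  rewrite [RHS]big_add1 /= big_nat [RHS]big_nat; apply: eq_bigr => j ij.
  rewrite Ghigh; last by lia.
  by rewrite scalerA -exprD addnS exprS mulN1r scaleNr opprK addnC.
rewrite colL.
have -> : \sum_(i < q.+1) (-1) ^+ i *: (\sum_(j < q.+2) (-1) ^+ j *: G i j) =
    \sum_(0 <= i < q.+1) (low i + high i + (D i - D i.+1)).
  by rewrite big_mkord; apply: eq_bigr => i _; rewrite rowG // -ltnS.
rewrite big_split /= -[X in _ + X + _]opprK -sumrN.
under [X in _ - X + _]eq_bigr do rewrite opprB.
rewrite telescope_sumr // opprB addrAC -[RHS]add0r; congr (_ + _).
rewrite !big_split /= big_nat_recl // [X in _ + X - _]big_nat_recr //=.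
rewrite /low /high big_nil [X in _ + (_ + X)]big_geq // add0r addr0.
by rewrite subrr.
Qed.
(** * Vertex-preserving affine maps from a simplex to a prism *)

Lemma continuous_row (T U : topologicalType) (m : nat) (g : T -> 'rV[U]_m) :
  (forall k, continuous (fun x => g x ord0 k)) -> continuous g.
Proof.
move=> gc x A [P Px PA].
have: \forall y \near x, forall k, P ord0 k (g y ord0 k).
  by apply: filter_forall => k; apply: gc; exact: Px.
by apply: filterS => y Py; apply: PA => a k; rewrite (ord1 a).
Qed.

(** This is the affine function on the simplex with value 1 at the vertices in P
and 0 at the others. *)
Definition vertex_weight (R : realType) (m : nat) (P : pred 'I_m.+1)
    (x : simplex R m) : R := \sum_(j | P j) (set_val x : 'rV_m.+1) ord0 j.

Lemma vertex_weight_continuous (R : realType) (m : nat) (P : pred 'I_m.+1) :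
  continuous (@vertex_weight R m P).
Proof.
apply: continuous_big => [|j _].
  by move=> x; exact: add_continuous.
move=> x; apply: (@continuous_comp _ _ _ (set_val : simplex R m -> _)
  (fun y : 'rV_m.+1 => y ord0 j)).
  exact: initial_continuous.
exact: coord_continuous.
Qed.

Lemma simplex_coord (R : realType) (m : nat) (x : simplex R m) :
  (forall j, 0 <= (set_val x : 'rV_m.+1) ord0 j) /\ vertex_weight predT x = 1.
Proof. exact: (set_valP x). Qed.

Fact vertex_weight_unit (R : realType) (m : nat) (P : pred 'I_m.+1)
    (x : simplex R m) :
  vertex_weight P x \in ([set` `[0%R, 1%R]] : set R).
Proof.
have [x0 x1] := simplex_coord x; apply/mem_set => /=.
rewrite in_itv /= sumr_ge0 //= -x1 /vertex_weight [leRHS](bigID P) /=.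
by rewrite lerDl sumr_ge0.
Qed.

(** This is the affine map that sends the j-th vertex to the vertex u j; both
face and degeneracy maps are of this form. *)
Definition push_row (R : realType) (m q : nat) (u : 'I_m.+1 -> 'I_q.+1)
    (x : simplex R m) : 'rV[R]_q.+1 :=
  \row_k vertex_weight (fun j => u j == k) x.

Fact push_subproof (R : realType) (m q : nat) (u : 'I_m.+1 -> 'I_q.+1)
    (x : simplex R m) :
  push_row u x \in @simplex_set R q.
Proof.
have [x0 x1] := simplex_coord x.
apply/mem_set; split=> [k|]; first by rewrite mxE sumr_ge0.
rewrite -x1 [RHS](partition_big u predT) //=.
by apply: eq_bigr => k _; rewrite mxE.
Qed.

Definition prism_fun (R : realType) (m q : nat) (u : 'I_m.+1 -> 'I_q.+1)
    (P : pred 'I_m.+1) (x : simplex R m) :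
    (unit_interval R * simplex R q)%type :=
  (exist _ (vertex_weight P x) (vertex_weight_unit P x),
   exist _ (push_row u x) (push_subproof u x)).

Lemma prism_fun_continuous (R : realType) (m q : nat) (u : 'I_m.+1 -> 'I_q.+1)
    (P : pred 'I_m.+1) : continuous (@prism_fun R m q u P).
Proof.
have wc : continuous (fun x : simplex R m => (prism_fun u P x).1).
  apply: (@continuous_comp_initial _ _ _ (set_val : unit_interval R -> R)).
  exact: vertex_weight_continuous.
have rc : continuous (fun x : simplex R m => (prism_fun u P x).2).
  apply: (@continuous_comp_initial _ _ _ (set_val : simplex R q -> 'rV_q.+1)).
  apply: (@continuous_row _ R) => k.
  have -> : (fun x => push_row u x ord0 k) =
      @vertex_weight R m (fun j => u j == k).
    by apply/funext => z; rewrite mxE.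
  exact: vertex_weight_continuous.
by move=> x; exact: cvg_pair (wc x) (rc x).
Qed.

Definition prism_simplex (R : realType) (X Y : topologicalType)
    (K : continuousType (unit_interval R * X)%type Y) (m q : nat)
    (s : continuousType (simplex R q) X) (u : 'I_m.+1 -> 'I_q.+1)
    (P : pred 'I_m.+1) (x : simplex R m) : Y :=
  K ((prism_fun u P x).1, s (prism_fun u P x).2).

Fact prism_simplex_continuous (R : realType) (X Y : topologicalType)
    (K : continuousType (unit_interval R * X)%type Y) (m q : nat)
    (s : continuousType (simplex R q) X) (u : 'I_m.+1 -> 'I_q.+1)
    (P : pred 'I_m.+1) : continuous (prism_simplex K s u P).
Proof.
have uPc := @prism_fun_continuous R m q u P.
have tc : continuous (fun x : simplex R m => (prism_fun u P x).1).
  by move=> x; apply: continuous_comp (uPc x) _; exact: cvg_fst.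
have sc : continuous (fun x : simplex R m => s (prism_fun u P x).2).
  move=> x; apply: (@continuous_comp _ _ _
    (fun x : simplex R m => (prism_fun u P x).2) s); last exact: cts_fun.
  by apply: continuous_comp (uPc x) _; exact: cvg_snd.
move=> x; apply: (@continuous_comp _ _ _
  (fun x : simplex R m => ((prism_fun u P x).1, s (prism_fun u P x).2)) K).
  exact: cvg_pair (tc x) (sc x).
exact: cts_fun.
Qed.
HB.instance Definition _ (R : realType) (X Y : topologicalType)
    (K : continuousType (unit_interval R * X)%type Y) (m q : nat)
    (s : continuousType (simplex R q) X) (u : 'I_m.+1 -> 'I_q.+1)
    (P : pred 'I_m.+1) :=
  isContinuous.Build (simplex R m) Y (prism_simplex K s u P)
    (@prism_simplex_continuous R X Y K m q s u P).

(** A face map is affine and sends the i-th vertex to the vertex lift j i, so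
composing an affine function with it is reindexing its values at vertices. All
compatibilities with faces below rest on this. *)
Lemma vertex_weight_face (R : realType) (m : nat) (P : pred 'I_m.+2)
    (j : 'I_m.+2) (x : simplex R m) :
  vertex_weight P (face_fun j x) =
  vertex_weight (fun i => P (fintype.lift j i)) x.
Proof.
rewrite /vertex_weight !(big_mkcond P) (bigD1_ord j) //= mxE unlift_none.
rewrite if_same add0r [RHS]big_mkcond; apply: eq_bigr => i _.
by rewrite mxE liftK.
Qed.

Lemma prism_simplex_face (R : realType) (X Y : topologicalType)
    (K : continuousType (unit_interval R * X)%type Y) (m q : nat)
    (s : continuousType (simplex R q) X) (u : 'I_m.+2 -> 'I_q.+1)
    (P : pred 'I_m.+2) (j : 'I_m.+2) :
  prism_simplex K s u P \o face R j =
  prism_simplex K s (fun i => u (fintype.lift j i))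
    (fun i => P (fintype.lift j i))
  :> continuousType (simplex R m) Y.
Proof.
apply/continuousEP => x; congr (K (_, s _)); apply: val_inj => /=.
  exact: vertex_weight_face.
by apply/rowP => k; rewrite !mxE; exact: vertex_weight_face.
Qed.

(** The j-th coordinate of a point of the j-th face is 0, in accordance with
j being outside the image of lift j; the other coordinates are sums over the
same fibers, lift j being injective. *)
Lemma prism_simplex_of_face (R : realType) (X Y : topologicalType)
    (K : continuousType (unit_interval R * X)%type Y) (m q : nat)
    (s : continuousType (simplex R q.+1) X) (u : 'I_m.+1 -> 'I_q.+1)
    (P : pred 'I_m.+1) (j : 'I_q.+2) :
  prism_simplex K (s \o face R j) u P =
  prism_simplex K s (fun i => fintype.lift j (u i)) P
  :> continuousType (simplex R m) Y.
Proof.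
apply/continuousEP => x; congr (K (_, s _)); apply: val_inj => /=.
apply/rowP => k; rewrite !mxE /vertex_weight; case: unliftP => [l ->|->].
  rewrite mxE; apply: eq_bigl => i; exact/esym/(inj_eq lift_inj).
by rewrite big_pred0 // => i; rewrite eq_sym (negPf (neq_lift _ _)).
Qed.

Lemma eq_prism_simplex (R : realType) (X Y : topologicalType)
    (K : continuousType (unit_interval R * X)%type Y) (m q : nat)
    (s : continuousType (simplex R q) X) (u v : 'I_m.+1 -> 'I_q.+1)
    (P Q : pred 'I_m.+1) :
  (forall i, u i = v i :> nat) -> P =1 Q ->
  prism_simplex K s u P = prism_simplex K s v Q
  :> continuousType (simplex R m) Y.
Proof.
move=> uv PQ; have {}uv : u = v by apply/funext => i; apply: val_inj; exact: uv.
by rewrite uv; move/funext: PQ => ->.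
Qed.

(** This identifies the two ends of the prism: P full gives time 1 and P empty
gives time 0. *)
Lemma prism_simplex_id (R : realType) (X Y : topologicalType)
    (K : continuousType (unit_interval R * X)%type Y) (q : nat)
    (s : continuousType (simplex R q) X) (P : pred 'I_q.+1)
    (g : continuousType X Y) (b : unit_interval R) :
  (forall x, g x = K (b, x)) ->
  (forall x, vertex_weight P x = set_val b) ->
  prism_simplex K s id P = g \o s :> continuousType (simplex R q) Y.
Proof.
move=> gK Pb; apply/continuousEP => x /=; rewrite gK.
congr (K (_, s _)); apply: val_inj; first exact: Pb.
by apply/rowP => k; rewrite mxE /vertex_weight big_pred1_eq.
Qed.

(** * The prism operator and homotopy invariance *)

(** The i-th simplex of the standard triangulation of the prism has the vertices
0, ..., i at time 0 followed by i, ..., q at time 1. *)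
Definition prism_chain (R : realType) (X Y : topologicalType)
    (K : continuousType (unit_interval R * X)%type Y) (q : nat)
    (s : continuousType (simplex R q) X) : chain R Y q.+1 :=
  \sum_(i < q.+1) (-1) ^+ i *: chain_of (prism_simplex K s
    (fun k : 'I_q.+2 => inord (unbump i k)) (fun k => i < k)%N).

Definition prism (R : realType) (X Y : topologicalType)
    (K : continuousType (unit_interval R * X)%type Y) (q : nat) :
    chain R X q -> chain R Y q.+1 :=
  fglift (prism_chain K (q := q)).
HB.instance Definition _ (R : realType) (X Y : topologicalType)
    (K : continuousType (unit_interval R * X)%type Y) (q : nat) :=
  GRing.isLinear.Build (Cplx R) (chain R X q) (chain R Y q.+1) _
    (@prism R X Y K q) (fglift_is_linear (prism_chain K (q := q))).

Lemma prism_chain_of (R : realType) (X Y : topologicalType)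
    (K : continuousType (unit_interval R * X)%type Y) (q : nat)
    (s : continuousType (simplex R q) X) :
  prism K (chain_of s) = prism_chain K s.
Proof. by rewrite /prism liftU scale1r. Qed.

(** The second sum is the prism operator applied to the boundary of s, written
without reference to the faces of s so that it makes sense, and vanishes, for
q = 0. *)
Lemma boundary_prism_chain (R : realType) (X Y : topologicalType)
    (K : continuousType (unit_interval R * X)%type Y)
    (b0 b1 : unit_interval R) (g0 g1 : continuousType X Y) (q : nat)
    (s : continuousType (simplex R q) X) :
  set_val b0 = 0 -> set_val b1 = 1 ->
  (forall x, g0 x = K (b0, x)) -> (forall x, g1 x = K (b1, x)) ->
  boundary (prism_chain K s) +
  \sum_(j < q.+1) (-1) ^+ j *: (\sum_(i < q) (-1) ^+ i *:
    (chain_of (prism_simplex K s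
      (fun k : 'I_q.+1 => inord (bump j (unbump i k))) (fun k => i < k)%N)
      : chain R Y q)) =
  chain_map g1 (chain_of s) - chain_map g0 (chain_of s).
Proof.
move=> b0E b1E g0E g1E.
pose D i : chain R Y q :=
  chain_of (prism_simplex K s (@id 'I_q.+1) (fun k => i <= k)%N).
pose G (i j : nat) : chain R Y q := chain_of (prism_simplex K s
  (fun k : 'I_q.+1 => inord (unbump i (bump j k))) (fun k => i < bump j k)%N).
pose L (i j : nat) : chain R Y q := chain_of (prism_simplex K s
  (fun k : 'I_q.+1 => inord (bump j (unbump i k))) (fun k => i < k)%N).
have -> : chain_map g1 (chain_of s) = D 0%N.
  rewrite chain_map_of; congr chain_of; apply/esym/(prism_simplex_id s g1E)=> x.
  by rewrite b1E; have [_ <-] := simplex_coord x.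
have -> : chain_map g0 (chain_of s) = D q.+1.
  rewrite chain_map_of; congr chain_of; apply/esym/(prism_simplex_id s g0E)=> x.
  rewrite b0E /vertex_weight big_pred0 // => k.
  by rewrite ltnNge -ltnS ltn_ord.
rewrite -(@prism_telescope _ _ q D G L); first congr (_ + _).
- rewrite /prism_chain linear_sum; apply: eq_bigr => i _.
  rewrite linearZ; congr (_ *: _).
  rewrite [LHS]boundary_chain_of; apply: eq_bigr => j _.
  by congr (_ *: chain_of _); exact: prism_simplex_face.
- move=> i iq; congr chain_of; apply: eq_prism_simplex => k /=.
    by rewrite bumpK inord_val.
  by rewrite /bump; lia.
- move=> i iq; congr chain_of; apply: eq_prism_simplex => k /=.
    have kq := ltn_ord k.
    have -> : unbump i (bump i.+1 k) = k by rewrite /bump /unbump; lia.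
    by rewrite inord_val.
  by rewrite /bump; lia.
- move=> i j ijq; congr chain_of; apply: eq_prism_simplex => k /=.
    by congr (nat_of_ord (inord _)); rewrite /bump /unbump; lia.
  by rewrite /bump; lia.
move=> i j ijq; congr chain_of; apply: eq_prism_simplex => k /=.
  by congr (nat_of_ord (inord _)); rewrite /bump /unbump; lia.
by rewrite /bump; lia.
Qed.

Lemma boundary_prism0 (R : realType) (X Y : topologicalType)
    (K : continuousType (unit_interval R * X)%type Y)
    (b0 b1 : unit_interval R) (g0 g1 : continuousType X Y)
    (z : chain R X 0) :
  set_val b0 = 0 -> set_val b1 = 1 ->
  (forall x, g0 x = K (b0, x)) -> (forall x, g1 x = K (b1, x)) ->
  boundary (prism K z) = chain_map g1 z - chain_map g0 z.
Proof.
move=> b0E b1E g0E g1E.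
pose F : {linear chain R X 0 -> chain R Y 0} :=
  (@boundary R Y 1 \o @prism R X Y K 0) + @chain_map R X Y g0 0.
suff /(_ z) <- : F =1 @chain_map R X Y g1 0 by rewrite /= addrK.
apply: chain_ext => s /=; rewrite prism_chain_of.
rewrite -[RHS](subrK (chain_map g0 (chain_of s))); congr (_ + _).
rewrite -(boundary_prism_chain s b0E b1E g0E g1E) big1 ?addr0 // => j _.
by rewrite big_ord0 scaler0.
Qed.

Lemma boundary_prismS (R : realType) (X Y : topologicalType)
    (K : continuousType (unit_interval R * X)%type Y)
    (b0 b1 : unit_interval R) (g0 g1 : continuousType X Y) (q : nat)
    (z : chain R X q.+1) :
  set_val b0 = 0 -> set_val b1 = 1 ->
  (forall x, g0 x = K (b0, x)) -> (forall x, g1 x = K (b1, x)) ->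
  boundary (prism K z) + prism K (boundary z) =
  chain_map g1 z - chain_map g0 z.
Proof.
move=> b0E b1E g0E g1E.
pose F : {linear chain R X q.+1 -> chain R Y q.+1} :=
  (@boundary R Y q.+2 \o @prism R X Y K q.+1) +
  (@prism R X Y K q \o @boundary R X q.+1) + @chain_map R X Y g0 q.+1.
suff /(_ z) <- : F =1 @chain_map R X Y g1 q.+1 by rewrite /= addrK.
apply: chain_ext => s /=; rewrite prism_chain_of.
rewrite -[RHS](subrK (chain_map g0 (chain_of s))); congr (_ + _).
rewrite -(boundary_prism_chain s b0E b1E g0E g1E); congr (_ + _).
rewrite [X in prism K X]boundary_chain_of linear_sum.
apply: eq_bigr => j _; rewrite linearZ; congr (_ *: _).
rewrite [LHS]prism_chain_of; apply: eq_bigr => i _; congr (_ *: chain_of _).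
rewrite prism_simplex_of_face; apply: eq_prism_simplex => // k /=.
have [[kq iq] jq] := (ltn_ord k, ltn_ord i, ltn_ord j).
have uq : (unbump i k < q.+1)%N by rewrite /unbump; lia.
by rewrite (inordK uq) inordK // /bump; lia.
Qed.

(** On a cycle z the term prism K (boundary z) vanishes, so the images of z
under the two ends of the homotopy differ by the boundary of prism K z. Degree 0
is separate because the boundary of a 0-chain lives again in degree 0. *)
Lemma sing_homology_map_homotopy (R : realType) (X Y : topologicalType)
    (K : continuousType (unit_interval R * X)%type Y)
    (b0 b1 : unit_interval R) (g0 g1 : continuousType X Y) (q : nat) :
  set_val b0 = 0 -> set_val b1 = 1 ->
  (forall x, g0 x = K (b0, x)) -> (forall x, g1 x = K (b1, x)) ->
  @sing_homology_map R X Y g1 q =1 @sing_homology_map R X Y g0 q.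
Proof.
move=> b0E b1E g0E g1E x; apply/hclass_eq; exists (prism K (\val (repr x))).
case: q x => [|q] x; first exact/esym/(boundary_prism0 _ b0E b1E).
rewrite [LHS]/= -(boundary_prismS _ b0E b1E g0E g1E).
have /eqP -> : boundary (\val (repr x)) == 0 by exact: (valP (repr x)).
by rewrite linear0 addr0.
Qed.

Lemma sing_homology_map_comp (R : realType) (X Y Z : topologicalType)
    (g : continuousType X Y) (k : continuousType Y Z) (q : nat)
    (x : sing_homology R X q) :
  sing_homology_map k (sing_homology_map g x) = sing_homology_map (k \o g) x.
Proof.
rewrite [LHS](homology_mapE (f1 := @chain_map R Y Z k q.+1)
  (@boundary_chain_map R Y Z k q.+1)); congr (hclass _ _); apply: val_inj => /=.
pose F : {linear chain R X q -> chain R Z q} :=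
  @chain_map R Y Z k q \o @chain_map R X Y g q.
suff /(_ (\val (repr x))) : F =1 @chain_map R X Z (k \o g) q by [].
apply: chain_ext => s /=; rewrite !chain_map_of; congr chain_of.
exact/continuousEP.
Qed.

(** * Monodromy and vanishing cycles *)

Lemma circle_loop_disk (R : realType) (c s : Cplx R) (eps t : R) :
  disk c eps s -> disk c eps (circle_loop c s t).
Proof.
rewrite /disk /= /circle_loop addrAC subrr add0r normrM => cs.
suff -> : `|(cos (2 * pi * t) +i* sin (2 * pi * t))%C : Cplx R| = 1.
  by rewrite mulr1.
by rewrite [LHS]normc_def /= cos2Dsin2 sqrtr1.
Qed.

Theorem lemma9 (R : realType) (n : nat) (n_ge2 : (2 <= n)%N)
    (f : mpoly.mpoly n (Cplx R))
    (f_isolated : critical_points f `<=` isolated (critical_points f))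
    (B : set (Cplx R)) (f_B : is_bifurcation_set f B)
    (c : Cplx R) (eps : R) (eps_gt0 : 0 < eps)
    (disk_B : disk c eps `&` B `<=` [set c])
    (s : Cplx R) (s_disk : disk c eps s) (s_neq_c : s != c)
    (q : nat)
    (h : sing_homology R (set_type (fiber f s)) q ->
         sing_homology R (set_type (fiber f s)) q)
    (h_monodromy : is_monodromy f c s h)
    (lambda : Cplx R) (p : nat) :
  lambda != 1 ->
  gen_eigenspace h lambda p `<=` vanishing_cycles f s_disk q.
Proof.
case: h_monodromy => g [Phi [[Phi_cont _] Phi1 Phi_start Phi_end]] ->.
(* Forgetting the time coordinate turns the trivialization of the pullback into
   a homotopy of maps from the fiber to the tube. *)
pose K0 (tx : (unit_interval R * set_type (fiber f s))%type) : 'rV[Cplx R]_n :=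
  (set_val (Phi tx)).2.
have K0_tube tx : K0 tx \in tube f c eps.
  apply/mem_set; rewrite /tube /= [polyfun f _](set_valP (Phi tx)).
  exact: circle_loop_disk.
have K_cont : continuous
    (fun tx => exist _ (K0 tx) (K0_tube tx) : set_type (tube f c eps)).
  apply: (@continuous_comp_initial _ _ _
    (set_val : set_type (tube f c eps) -> 'rV[Cplx R]_n)).
  move=> tx; apply: (@continuous_comp _ _ _ (fun tx => set_val (Phi tx)) snd).
    apply: continuous_comp; first exact: Phi_cont.
    exact: initial_continuous.
  exact: cvg_snd.
have unit0 : (0 : R) \in ([set` `[0%R, 1%R]] : set R).
  by apply/mem_set; rewrite /= bound_itvE.
have unit1 : (1 : R) \in ([set` `[0%R, 1%R]] : set R).
  by apply/mem_set; rewrite /= bound_itvE.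
pose b0 : unit_interval R := exist _ 0 unit0.
pose b1 : unit_interval R := exist _ 1 unit1.
pose k := incl (fiber_sub_tube (f := f) s_disk).
apply: gen_eigenspace_sub_ker => x; rewrite /=.
rewrite sing_homology_map_comp.
apply: (@sing_homology_map_homotopy _ _ _ (mkcts K_cont) b0 b1) => // y.
  by apply: val_inj; rewrite /= /K0 Phi_start.
by apply: val_inj; rewrite /= /K0 Phi_end.
Qed.
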